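(* If $A$ is a finite brace, then $A$ contains a largest left nilpotent ideal (one containing every left nilpotent ideal of $A$), and it is the sum of all left nilpotent ideals in $A$.
   Context: A (left) brace is a set $A$ with operations $+,\circ$ such that $(A,+)$ is an abelian group, $(A,\circ)$ is a group, and $a\circ(b+c)+a=a\circ b+a\circ c$ for all $a,b,c\in A$. One writes $a*b=a\circ b-a-b$. An ideal of $A$ is a subgroup $I$ of $(A,+)$ such that $a*i\in I$ and $i*a\in I$ for all $a\in A$, $i\in I$. For subsets $X,Y\subseteq A$, $X*Y$ denotes the set of all finite sums of elements $x*y$ with $x\in X$, $y\in Y$. An ideal $I$ is left nilpotent if $I^{n}=0$ for some $n$, where $I^{1}=I$ and $I^{i+1}=I*I^{i}$. *)

(* Defs.v *)
From HB Require Import structures.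
From mathcomp Require Import all_boot all_order all_algebra.
From mathcomp Require Import boolp classical_sets.

Set Implicit Arguments.
Unset Strict Implicit.
Unset Printing Implicit Defensive.

Import GRing.Theory.
Local Open Scope classical_set_scope.
Local Open Scope ring_scope.

HB.mixin Record Zmodule_isBrace A of GRing.Zmodule A := {
  circ : A -> A -> A;
  circ1 : A;
  circV : A -> A;
  circA : associative circ;
  circ1x : left_id circ1 circ;
  circx1 : right_id circ1 circ;
  circVx : left_inverse circ1 circV circ;
  circxV : right_inverse circ1 circV circ;
  circD : forall a b c : A, circ a (b + c) + a = circ a b + circ a c
}.

#[short(type="braceType")]
HB.structure Definition Brace := {A of Zmodule_isBrace A & GRing.Zmodule A}.

#[short(type="finBraceType")]
HB.structure Definition FinBrace := {A of Brace A & Finite A}.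

Definition star (A : braceType) (a b : A) : A := circ a b - a - b.

(* The empty sum is allowed, so 0 always belongs to [star_set X Y]. *)
Definition star_set (A : braceType) (X Y : set A) : set A :=
  [set z | exists s : seq (A * A),
    (forall p, p \in s -> X p.1 /\ Y p.2) /\ z = \sum_(p <- s) star p.1 p.2].

Definition ideal (A : braceType) (I : set A) : Prop :=
  GRing.zmod_closed (mem I) /\
  forall a i : A, I i -> I (star a i) /\ I (star i a).

(* Powers start at exponent 1: [left_power I n] is I^(n+1), i.e.
   left_power I 0 = I and left_power I n.+1 = I * left_power I n. *)
Definition left_power (A : braceType) (I : set A) (n : nat) : set A :=
  iter n (star_set I) I.

Definition left_nilpotent_ideal (A : braceType) (I : set A) : Prop :=
  ideal I /\ exists n : nat, left_power I n = [set 0].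

(* Sum of an arbitrary family of subsets: all finite sums of elements, each
   of which lies in some member of the family. *)
Definition sum_family (A : braceType) (F : set (set A)) : set A :=
  [set z | exists s : seq A,
    (forall x, x \in s -> exists2 I, F I & I x) /\ z = \sum_(x <- s) x].

Definition largest (T : Type) (F : set (set T)) (L : set T) : Prop :=
  F L /\ forall I, F I -> I `<=` L.

(* Main.v *)
Require Import Defs.
From mathcomp Require Import all_boot all_order all_algebra.
From mathcomp Require Import boolp classical_sets.

(** Write [lam a b = circ a b - a].  Then [lam] is an action of the group
    [(A, circ)] on the abelian group [(A, +)], and [star a b = lam a b - b], so
    that [star_set I V] is the commutator [[I, V]] of this action.  Since
    [star_set I A] is contained in an ideal [I], left nilpotency of [I] says
    exactly that [I] acts nilpotently on the whole of [A]: the chain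
    [A, I * A, I * (I * A), ...] reaches [0] ([left_nilpotentP]).

    Let [I] and [J] be two left nilpotent ideals.  An ideal is a normal subgroup
    of [(A, circ)], so every term [V_k] of the chain of [I] is a submodule of [A]
    under [lam] ([star_chain_submodule]).  Every element of [I + J] is a product
    [circ i j]; the factor [i] acts trivially on [V_k / V_(k+1)], hence [I + J]
    acts on this quotient as [J] does, that is, nilpotently with a uniform bound
    ([star_chain_add]).  Climbing down the finite chain of [I] shows that [I + J]
    acts nilpotently on [A] ([left_nilpotent_add]).  Thus left nilpotent ideals
    are directed under inclusion, and in a finite brace finitely many of them
    already cover the union of all of them ([left_nilpotent_cover]). *)

Set Implicit Arguments.
Unset Strict Implicit.
Unset Printing Implicit Defensive.

Import GRing.Theory.
Local Open Scope classical_set_scope.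
Local Open Scope ring_scope.

(** * The lambda action *)

Section LambdaAction.
Variable A : braceType.
Implicit Types a b c v : A.

Definition lam a b : A := circ a b - a.

Lemma circE a b : circ a b = a + lam a b.
Proof. by rewrite /lam addrC subrK. Qed.

Lemma starE a b : star a b = lam a b - b.
Proof. by []. Qed.

Lemma lamE a b : lam a b = star a b + b.
Proof. by rewrite starE subrK. Qed.

Lemma lamD a : {morph lam a : b c / b + c}.
Proof.
move=> b c; have /(canRL (addrK _)) e := circD a b c.
by rewrite /lam e -addrA [RHS]addrACA.
Qed.

Lemma lam0 a : lam a 0 = 0.
Proof. by apply: (addrI (lam a 0)); rewrite -lamD !addr0. Qed.

Lemma lamN a : {morph lam a : b / - b}.
Proof. by move=> b; apply: (addrI (lam a b)); rewrite -lamD !subrr lam0. Qed.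

Lemma lamB a : {morph lam a : b c / b - c}.
Proof. by move=> b c; rewrite lamD lamN. Qed.

Lemma lam_sum a (T : Type) (s : seq T) (F : T -> A) :
  lam a (\sum_(x <- s) F x) = \sum_(x <- s) lam a (F x).
Proof. exact: (big_morph _ (lamD a) (lam0 a)). Qed.

(** The two groups of a brace share their neutral element. *)
Lemma brace_circ1 : circ1 = 0 :> A.
Proof. by rewrite -[RHS](@circ1x A) circE lam0 addr0. Qed.

Lemma lamM a b c : lam (circ a b) c = lam a (lam b c).
Proof. by rewrite [lam b c]/lam lamB /lam -(@circA A) opprB addrA subrK. Qed.

Lemma lamKV a b : lam a (lam (circV a) b) = b.
Proof. by rewrite -lamM (@circxV A) /lam (@circ1x A) brace_circ1 subr0. Qed.

Lemma starN a b : star a (- b) = - star a b.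
Proof. by rewrite !starE lamN [RHS]opprD. Qed.

Lemma starD a b c : star a (b + c) = star a b + star a c.
Proof. by rewrite !starE lamD opprD addrACA. Qed.

Lemma star_circ a b c :
  star (circ a b) c = star a (star b c) + star a c + star b c.
Proof.
rewrite starE lamM (lamE b) lamD (lamE a (star b c)) -addrA -starE.
by rewrite addrAC.
Qed.

End LambdaAction.

(** * Submodules, ideals and commutator chains *)

Section Submodules.
Variable A : braceType.
Implicit Types (a b v i j : A) (I J K S V W : set A).

Definition submodule S : Prop :=
  [/\ S 0, forall x y, S x -> S y -> S (x - y)
    & forall a v, S v -> S (lam a v)].

Lemma submoduleN S x : submodule S -> S x -> S (- x).
Proof. by case=> S0 SB _ Sx; rewrite -sub0r; apply: SB. Qed.

Lemma submoduleD S x y : submodule S -> S x -> S y -> S (x + y).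
Proof.
move=> mS Sx Sy; rewrite -[y]opprK; case: (mS) => _ SB _.
by apply: SB => //; apply: submoduleN.
Qed.

Lemma submodule_star S a v : submodule S -> S v -> S (star a v).
Proof. by case=> _ SB Slam Sv; rewrite starE; apply: SB => //; apply: Slam. Qed.

Lemma submodule_sum S (T : eqType) (s : seq T) (F : T -> A) :
  submodule S -> (forall x, x \in s -> S (F x)) -> S (\sum_(x <- s) F x).
Proof.
move=> mS SF; rewrite big_seq.
by apply: big_ind => //; [case: mS | move=> x y; apply: submoduleD].
Qed.

Lemma submodule_setT : submodule setT. Proof. by []. Qed.

Lemma idealP I :
  ideal I <-> submodule I /\ forall i a, I i -> I (star i a).
Proof.
split=> [[[I0 IB] Istar] | [mI Istar]].
  have I0' : I 0 by rewrite inE in I0.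
  have IB' x y : I x -> I y -> I (x - y).
    by move=> Ix Iy; have := IB x y; rewrite !inE; apply.
  split; last by move=> i a /(Istar a)[].
  split=> // a v Iv; have [Iav _] := Istar a _ Iv.
  rewrite lamE -[X in _ + X]opprK; apply: (IB') => //.
  by rewrite -sub0r; apply: IB'.
split; last by move=> a i Ii; split; [apply: submodule_star | apply: Istar].
case: (mI) => I0 IB _.
by split; [rewrite inE | move=> x y; rewrite !inE; apply: IB].
Qed.

(** Ideals are normal in the circle group.  The product
    [circ i (circV a)] equals [m + circV a] with [m = i + star i (circV a)] in
    [I], and the affine map [circ a] sends [m + circV a] to [lam a m]. *)
Lemma ideal_conj I a i : ideal I -> I i -> I (circ (circ a i) (circV a)).
Proof.
case/idealP=> mI Istar Ii; rewrite -(@circA A) (circE i) lamE addrA circE lamD.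
rewrite addrCA -circE (@circxV A) brace_circ1 addr0.
by case: (mI) => _ _; apply; apply: submoduleD => //; apply: Istar.
Qed.

Lemma lam_star a i v :
  lam a (star i v) = star (circ (circ a i) (circV a)) (lam a v).
Proof.
by rewrite !starE lamB -!lamM -!(@circA A) (@circVx A) (@circx1 A).
Qed.

Lemma star_set1 I V i v : I i -> V v -> star_set I V (star i v).
Proof.
move=> Ii Vv; exists [:: (i, v)]; rewrite big_seq1; split=> // p.
by rewrite inE => /eqP ->.
Qed.

Lemma star_set_sub I V S :
  submodule S -> (forall i v, I i -> V v -> S (star i v)) ->
  star_set I V `<=` S.
Proof.
move=> mS IVS z [s [sIV ->]]; apply: submodule_sum => // p /sIV[].
exact: IVS.
Qed.

Lemma star_setS I V W : V `<=` W -> star_set I V `<=` star_set I W.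
Proof.
move=> VW z [s [sIV ->]]; exists s; split=> // p /sIV[Ip Vp].
by split=> //; apply: VW.
Qed.

Lemma star_set_submodule I V :
  ideal I -> submodule V -> submodule (star_set I V).
Proof.
move=> idI mV; split.
- by exists [::]; rewrite big_nil.
- move=> _ _ [s [sIV ->]] [t [tIV ->]].
  exists (s ++ [seq (p.1, - p.2) | p <- t]); split.
    move=> p; rewrite mem_cat => /orP[/sIV // | /mapP[q /tIV[Iq Vq] ->]].
    by split=> //; apply: submoduleN.
  rewrite big_cat big_map /= -sumrN; congr (_ + _).
  by apply: eq_bigr => p _; rewrite starN.
- move=> a _ [s [sIV ->]].
  exists [seq (circ (circ a p.1) (circV a), lam a p.2) | p <- s]; split.
    move=> _ /mapP[p /sIV[Ip Vp] ->]; split; first exact: ideal_conj.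
    by case: mV => _ _; apply.
  by rewrite big_map lam_sum; apply: eq_bigr => p _; rewrite lam_star.
Qed.

(** The chain [V, I * V, I * (I * V), ...]. *)
Definition star_chain I V n : set A := iter n (star_set I) V.

Lemma star_chainS I V W n :
  V `<=` W -> star_chain I V n `<=` star_chain I W n.
Proof. by move=> VW; elim: n => //= n; apply: star_setS. Qed.

Lemma star_chain_submodule I V n :
  ideal I -> submodule V -> submodule (star_chain I V n).
Proof. by move=> idI mV; elim: n => //= n; apply: star_set_submodule. Qed.

Lemma star_chain_sub I V n : submodule V -> star_chain I V n `<=` V.
Proof.
move=> mV; elim: n => //= n IHn; apply: star_set_sub => // i v _ /IHn.
exact: submodule_star.
Qed.

(** Replacing [I] by [A] at the start of the chain costs one step, because
    [I * A] lies in [I]. *)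
Lemma left_nilpotentP I :
  left_nilpotent_ideal I <->
  ideal I /\ exists n, star_chain I setT n `<=` [set 0].
Proof.
split=> -[idI [n In]]; split=> //; have [mI Istar] := (idealP I).1 idI.
  exists n.+1; rewrite -In /star_chain iterSr; apply: star_chainS.
  by apply: star_set_sub => // i v Ii _; apply: Istar.
exists n; apply/seteqP; split; first exact: subset_trans (star_chainS _) In.
by move=> _ ->; case: (star_chain_submodule n idI mI).
Qed.

(** * Sums of two ideals *)

Definition set_add V W : set A :=
  [set z | exists v w, [/\ V v, W w & z = v + w]].

Lemma sub_set_addl V W : submodule W -> V `<=` set_add V W.
Proof. by case=> W0 _ _ v Vv; exists v, 0; rewrite addr0. Qed.

Lemma sub_set_addr V W : submodule V -> W `<=` set_add V W.
Proof. by case=> V0 _ _ w Ww; exists 0, w; rewrite add0r. Qed.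

Lemma set_add_submodule V W :
  submodule V -> submodule W -> submodule (set_add V W).
Proof.
move=> [V0 VB Vlam] [W0 WB Wlam]; split.
- by exists 0, 0; rewrite addr0.
- move=> _ _ [v [w [Vv Ww ->]]] [v' [w' [Vv' Ww' ->]]].
  exists (v - v'), (w - w'); split; [exact: VB | exact: WB |].
  by rewrite opprD addrACA.
- move=> a _ [v [w [Vv Ww ->]]]; exists (lam a v), (lam a w).
  by split; [exact: Vlam | exact: Wlam | rewrite lamD].
Qed.

Lemma set_add_circ I J z :
  submodule J -> set_add I J z -> exists i j, [/\ I i, J j & z = circ i j].
Proof.
case=> _ _ Jlam [i [j [Ii Jj ->]]]; exists i, (lam (circV i) j).
by split; [| exact: Jlam | rewrite circE lamKV].
Qed.

Lemma ideal_add I J : ideal I -> ideal J -> ideal (set_add I J).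
Proof.
move=> /idealP[mI Istar] /idealP[mJ Jstar]; apply/idealP.
have mIJ := set_add_submodule mI mJ; split=> // z a /(set_add_circ mJ).
case=> i [j [Ii Jj ->]]; rewrite star_circ -addrA.
apply: submoduleD => //; first by apply: sub_set_addl => //; apply: Istar.
by exists (star i a), (star j a); split; [apply: Istar | apply: Jstar |].
Qed.

(** Modulo [star_set I V], an element [circ i j] acts on [V] as [j] does, so the
    chains of [I + J] and of [J] starting from [V] agree there. *)
Lemma star_chain_add I J V n :
  ideal I -> ideal J -> submodule V ->
  star_chain (set_add I J) V n `<=` set_add (star_set I V) (star_chain J V n).
Proof.
move=> idI idJ mV; have mIV := star_set_submodule idI mV.
have mJV m := star_chain_submodule m idJ mV.
have mJ := (iffLR (idealP J) idJ).1.
elim: n => [|n IHn]; first exact: sub_set_addr.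
apply: star_set_sub; first exact: set_add_submodule.
move=> z v /(set_add_circ mJ)[i [j [Ii Jj ->]]] /IHn[u [w [IVu Jw ->]]].
have Vw : V w := star_chain_sub mV Jw.
exists (star (circ i j) u + (star i (star j w) + star i w)), (star j w).
split; last by rewrite starD (star_circ _ _ w) addrA.
  apply: submoduleD (submodule_star _ mIV IVu) _ => //.
  by apply: submoduleD => //; apply: star_set1 => //; apply: submodule_star.
exact: star_set1.
Qed.

Lemma left_nilpotent_add I J :
  left_nilpotent_ideal I -> left_nilpotent_ideal J ->
  left_nilpotent_ideal (set_add I J).
Proof.
move=> /left_nilpotentP[idI [p Ip]] /left_nilpotentP[idJ [q Jq]].
apply/left_nilpotentP; split; first exact: ideal_add.
(* Each of the p successive quotients of the chain of I is killed in q steps. *)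
exists (p * q)%N; apply: subset_trans Ip; elim: p => [|p IHp] //.
have mIp := star_chain_submodule p idI submodule_setT.
rewrite mulSn /star_chain iterD; apply: subset_trans (star_chainS IHp) _.
apply: subset_trans (star_chain_add idI idJ mIp) _ => _ [v [w [Iv Jw ->]]].
suff -> : w = 0 by rewrite addr0.
exact/Jq/(star_chainS (@subsetT _ _) Jw).
Qed.

Lemma left_nilpotent0 : left_nilpotent_ideal [set 0 : A].
Proof.
split; last by exists 0%N.
apply/idealP; split; last first.
  move=> _ a ->.
  by rewrite starE /lam -brace_circ1 (@circ1x A) brace_circ1 subr0 subrr.
split=> // [_ _ -> ->|a _ ->]; first exact: subr0.
exact: lam0.
Qed.

(** Only the elements of the list that lie in some left nilpotent ideal matter:
    one such ideal is chosen for each of them, and these are added up. *)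
Lemma left_nilpotent_cover (s : seq A) :
  exists2 L, left_nilpotent_ideal L &
    forall I x, left_nilpotent_ideal I -> x \in s -> I x -> L x.
Proof.
elim: s => [|y s [L nL sL]].
  by exists [set 0]; first exact: left_nilpotent0.
have [[I [nI Iy]]|noI] := pselect (exists I, left_nilpotent_ideal I /\ I y).
  have [mI _] := (idealP I).1 nI.1; have [mL _] := (idealP L).1 nL.1.
  exists (set_add I L); first exact: left_nilpotent_add.
  move=> I' x nI'; rewrite inE => /predU1P[-> _ | xs I'x].
    exact: sub_set_addl.
  by apply: sub_set_addr => //; apply: sL I'x.
exists L => // I x nI; rewrite inE => /predU1P[-> Iy | xs]; last exact: sL.
by case: noI; exists I.
Qed.

End Submodules.

(** * The largest left nilpotent ideal *)

Theorem corollary21 (A : finBraceType) :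
  exists L : set A,
    largest (@left_nilpotent_ideal A) L /\
    L = sum_family (@left_nilpotent_ideal A).
Proof.
have [L nL coverL] := left_nilpotent_cover (enum A).
have maxL I : left_nilpotent_ideal I -> I `<=` L.
  by move=> nI x; apply: coverL; rewrite ?mem_enum.
exists L; split; first by split.
apply/seteqP; split=> [x Lx | _ [s [sF ->]]].
  exists [:: x]; rewrite big_seq1; split=> // y.
  by rewrite inE => /eqP ->; exists L.
have [mL _] := (idealP L).1 nL.1.
by apply: submodule_sum => // x /sF[I nI]; apply: maxL.
Qed.
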